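(* Let $N\ge 2$ be an integer, let $\mathcal{L}_N=\{0,1,\dots,N-1\}^2$, let $d_\infty(\mathbf i,\mathbf j)=\max(|i_1-j_1|,|i_2-j_2|)$ for $\mathbf i=(i_1,i_2),\mathbf j=(j_1,j_2)\in\mathcal{L}_N$, let $K$ be the complete directed graph (without self-loops) on $\mathcal{L}_N$, and let $G_1=(\mathcal{L}_N,E_1)$ with $$E_1=\{(\mathbf i,\mathbf i+\mathbf j):\ \mathbf i\in\mathcal{L}_N,\ \mathbf j\in V_1,\ \mathbf i+\mathbf j\in\mathcal{L}_N\},\qquad V_1=\{-1,0,1\}^2\setminus\{(0,0)\}.$$ Then $\Gamma_{G_1,d_\infty}=0$, and hence $F_{G_1,d_\infty}(b)=F_{K,d_\infty}(b)$ for every $b:\mathcal{L}_N\to\mathbb{R}$ with $\sum_{\mathbf i\in\mathcal{L}_N} b(\mathbf i)=0$. In particular, $$\mathcal{W}_{d_\infty}(\mu,\nu)=F_{G_1,d_\infty}(\mu-\nu)$$ for every pair of probability measures $\mu,\nu$ on $\mathcal{L}_N$.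
   Context: For a finite set $X$, a cost $c:X\times X\to[0,\infty)$ and probability vectors $\mu,\nu$ on $X$, $\mathcal{W}_c(\mu,\nu)=\inf_{\pi\in\Pi(\mu,\nu)}\sum_{(x,y)\in X\times X}c(x,y)\pi(x,y)$, where $\Pi(\mu,\nu)$ is the set of probability measures $\pi$ on $X\times X$ with $\sum_y\pi(x,y)=\mu(x)$ and $\sum_x\pi(x,y)=\nu(y)$ for all $x,y$. For a directed graph $G=(V,E)$ without self-loops, a cost $c$ on edges with values in $[0,\infty)$, and $b:V\to\mathbb{R}$ with $\sum_{v\in V}b(v)=0$, a $b$-flow is a function $f:E\to[0,\infty)$ with $\sum_{v:(u,v)\in E}f(u,v)-\sum_{v:(v,u)\in E}f(v,u)=b(u)$ for all $u\in V$; $\mathcal{F}(G,b)$ is the set of $b$-flows, and $F_{G,c}(b)=\min_{f\in\mathcal{F}(G,b)}\sum_{(u,v)\in E}c(u,v)f(u,v)$. For a directed graph $G$ with vertex set $X$ and a distance $c$ on $X$, $c_G(x,y)$ denotes the minimum, over all directed paths in $G$ from $x$ to $y$, of the sum of the costs $c$ of the edges of the path, and $\Gamma_{G,c}=\max\{1-c(x,y)/c_G(x,y):\ x,y\in X,\ x\neq y\}$. *)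

(* Defs.v *)
From HB Require Import structures.
From mathcomp Require Import all_boot all_order all_algebra.
From mathcomp Require Import all_classical all_reals.

Set Implicit Arguments.
Unset Strict Implicit.
Unset Printing Implicit Defensive.

Import Order.TTheory GRing.Theory Num.Theory.

Local Open Scope classical_set_scope.
Local Open Scope ring_scope.

Section Minimum.
Variable R : realType.
Implicit Types A : set R.

Definition has_min A : Prop := exists m, A m /\ lbound A m.

(* The value is meaningful only under [has_min A]; it is 0 otherwise. *)
Definition minimum A : R := xget 0 [set m | A m /\ lbound A m].

End Minimum.

Section Transport.
Variables (R : realType) (X : finType).
Implicit Types (c : X -> X -> R) (mu nu : X -> R).

Definition prob_vector (T : finType) (mu : T -> R) : Prop :=
  (forall x, 0 <= mu x) /\ \sum_x mu x = 1.

Definition couplings mu nu : set (X * X -> R) :=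
  [set pi | [/\ prob_vector pi,
                forall x, \sum_y pi (x, y) = mu x
              & forall y, \sum_x pi (x, y) = nu y]].

(* For probability vectors and c >= 0 the set is nonempty and bounded below,
   so the real-valued [inf] is the genuine infimum. *)
Definition wasserstein c mu nu : R :=
  inf [set \sum_(xy : X * X) c xy.1 xy.2 * pi xy | pi in couplings mu nu].

End Transport.

(* A directed graph on the vertex set V is given by its edge relation. *)
Section Flows.
Variables (R : realType) (V : finType).
Implicit Types (G : rel V) (c : V -> V -> R) (b : V -> R).

(* A function on the edges is represented by a function on V * V whose values
   off the edges are irrelevant: they are neither constrained nor summed. *)
Definition flows G b : set (V -> V -> R) :=
  [set f | (forall u v, G u v -> 0 <= f u v) /\
           (forall u, \sum_(v | G u v) f u v - \sum_(v | G v u) f v u = b u)].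

Definition flow_cost G c (f : V -> V -> R) : R :=
  \sum_(e : V * V | G e.1 e.2) c e.1 e.2 * f e.1 e.2.

Definition flow_costs G c b : set R :=
  [set flow_cost G c f | f in flows G b].

Definition min_flow_cost G c b : R := minimum (flow_costs G c b).

Definition path_costs G c (x y : V) : set R :=
  [set \sum_(w <- pairmap c x p) w | p in [set p | path G x p /\ last x p = y]].

(* When no directed path joins x to y this is 0 rather than +oo; since
   z / 0 = 0, the quotient c x y / path_dist G c x y is then 0, which is the
   value given by the convention c_G(x, y) = +oo. *)
Definition path_dist G c (x y : V) : R := minimum (path_costs G c x y).

(* The maximum is taken in \bar R with unit -oo, so that no lower bound is
   imposed on it; it is finite as soon as V has two distinct points. *)
Definition gap G c : \bar R :=
  \big[maxe/-oo%E]_(xy : V * V | xy.1 != xy.2)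
    (1 - c xy.1 xy.2 / path_dist G c xy.1 xy.2)%:E.

Definition complete_digraph : rel V := [rel u v | u != v].

End Flows.

Notation lattice N := ('I_N * 'I_N)%type.

Section Lattice.
Variables (R : realType) (N : nat).

Definition dinf (i j : lattice N) : R :=
  Num.max `|i.1%:R - j.1%:R| `|i.2%:R - j.2%:R|.

Definition V1 : seq (int * int) :=
  [seq v <- [seq (s, t) | s <- [:: -1; 0; 1], t <- [:: -1; 0; 1]] | v != (0, 0)].

Definition G1 : rel (lattice N) :=
  fun i k => has (fun v : int * int =>
                    (k.1%:Z == i.1%:Z + v.1) && (k.2%:Z == i.2%:Z + v.2)) V1.

End Lattice.

(* Main.v *)
Require Import Defs.
From HB Require Import structures.
From mathcomp Require Import all_boot all_order all_algebra.
From mathcomp Require Import all_classical all_reals.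
From mathcomp Require Import topology normedtype derive.
From mathcomp Require Import zify ring lra.

(** On the lattice with king moves, a move towards the target in each
coordinate that still differs lowers [dinf] by exactly one, so any two points
are joined by a path in [G1] whose cost is their distance
([dinf_path_costs]).  By the triangle inequality no path is cheaper; hence
[path_dist] is [dinf] and the gap vanishes ([gap_geodesic]).

For any metric cost realised by paths of a loopless graph [G], the flows on [G]
and on the complete graph have the same costs, not only the same minimum: a
flow on [G] extends by zero, and a flow on the complete graph is rerouted by
sending the mass of each edge along a geodesic, which preserves both
divergences and cost ([flow_costs_geodesic]).  It remains to relate complete
flows of divergence [mu - nu] to transport plans from [mu] to [nu].

A plan is a complete flow of the same cost, since the diagonal is free.
Conversely a flow may transship mass through intermediate vertices.  With [mu]
placed on the diagonal it becomes a plan between [mu + s] and [nu + s], where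
[s] is its outflow, and this plan is improved one vertex at a time:
everything passing through [v] is sent directly from its origins to its
destinations, which by the triangle inequality does not increase the cost and
makes [s v] vanish ([remove_transshipment]).  So the two problems have the same
infimum, and a minimum exists because the plans form a compact polytope
([plan_cost_min]).  For a general [b] of total mass zero this applies to its
positive and negative parts. *)

Set Implicit Arguments.
Unset Strict Implicit.
Unset Printing Implicit Defensive.

Import Order.TTheory GRing.Theory Num.Theory.
Import numFieldNormedType.Exports.

Local Open Scope classical_set_scope.
Local Open Scope ring_scope.

(** * Minima, sums and continuity *)

Lemma minimum_eq (R : realType) (A : set R) (m : R) :
  A m -> lbound A m -> minimum A = m.
Proof.
move=> Am lAm; rewrite /minimum.
case: xgetP => [x _ [Ax lAx]|/(_ m)]; last first.
  by case.
by apply/le_anti; rewrite lAx //= lAm.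
Qed.

Lemma inf_eq_min (R : realType) (A : set R) (m : R) :
  A m -> lbound A m -> inf A = m.
Proof.
move=> Am lAm; apply/le_anti/andP; split.
  by apply: ge_inf => //; exists m.
by apply: lb_le_inf => //; exists m.
Qed.

Lemma sum_indicator (R : pzSemiRingType) (I : finType) (i : I) (F : I -> R) :
  \sum_j (j == i)%:R * F j = F i.
Proof.
rewrite (bigD1 i) //= eqxx mul1r big1 ?addr0 // => j /negbTE ->.
by rewrite mul0r.
Qed.

Lemma continuous_sum (R : realType) (T : topologicalType) (I : finType)
    (F : I -> T -> R) :
  (forall i, continuous (F i)) -> continuous (fun x => \sum_i F i x).
Proof.
move=> Fc; apply: (@continuous_big R I +%R 0 xpredT _ T) => [|i _].
  exact: add_continuous.
exact: Fc.
Qed.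

Lemma continuous_scale (R : realType) (T : topologicalType) (a : R)
    (F : T -> R) :
  continuous F -> continuous (fun x => a * F x).
Proof. by move=> Fc x; apply: cvgM; [exact: cvg_cst|exact: Fc]. Qed.

(** * Transport plans and the existence of an optimal one *)

Section Plans.
Variables (R : realType) (V : finType).
Implicit Types (c f : V -> V -> R) (mu nu s : V -> R).

Definition plan mu nu f : Prop :=
  [/\ forall u v, 0 <= f u v,
      forall u, \sum_v f u v = mu u
    & forall v, \sum_u f u v = nu v].

Definition plan_cost c f : R := \sum_u \sum_v c u v * f u v.

Lemma plan_le mu nu f u v : plan mu nu f -> f u v <= mu u.
Proof.
by case=> f0 fr _; rewrite -fr (bigD1 v) //= lerDl sumr_ge0.
Qed.

(** The product plan, normalised by the common mass.  When that mass is zero,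
both marginals vanish and division by zero returns the zero plan. *)
Lemma plan_exists mu nu :
  (forall u, 0 <= mu u) -> (forall u, 0 <= nu u) ->
  \sum_u mu u = \sum_u nu u -> exists f, plan mu nu f.
Proof.
move=> mu0 nu0 e; pose t := \sum_u mu u.
have vanish (m : V -> R) u : (forall u, 0 <= m u) -> \sum_u m u = 0 -> m u = 0.
  move=> m0 /eqP; rewrite psumr_eq0 // => /allP /(_ u).
  by rewrite mem_index_enum => /(_ isT) /eqP.
have scale (m : V -> R) u : (forall u, 0 <= m u) -> \sum_u m u = t ->
    m u * t / t = m u.
  move=> m0 mt; have [t0|t0] := eqVneq t 0; last by rewrite mulfK.
  by rewrite (vanish m u) ?mt // mul0r mul0r.
exists (fun u v => mu u * nu v / t); split=> [u v|u|v].
- by rewrite divr_ge0 ?mulr_ge0 ?sumr_ge0.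
- by rewrite -mulr_suml -mulr_sumr -e scale.
- by rewrite -mulr_suml -mulr_suml -/t [t * _]mulrC scale.
Qed.

(** Entries of a plan are bounded by its row sums, so the plans form a closed
subset of a product of segments, which is compact by Tychonoff's theorem; the
cost is a continuous function on it. *)
Lemma plan_cost_min c mu nu :
  (forall u, 0 <= mu u) -> (forall u, 0 <= nu u) ->
  \sum_u mu u = \sum_u nu u ->
  exists2 f, plan mu nu f
           & forall g, plan mu nu g -> plan_cost c f <= plan_cost c g.
Proof.
move=> mu0 nu0 e.
pose T := prod_topology (fun _ : V * V => R : topologicalType).
have lin_cont (a : V -> V -> R) :
    continuous (fun g : T => plan_cost a (fun u v => g (u, v))).
  have coord u v : continuous (fun g : T => g (u, v)).
    exact: (@proj_continuous _ (fun _ : V * V => R : topologicalType) (u, v)).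
  apply: continuous_sum => u; apply: continuous_sum => v.
  by apply: continuous_scale; exact: coord.
(* Marginals are themselves plan costs, for indicator cost functions, so their
   continuity is an instance of [lin_cont]. *)
have rowE u (g : T) :
    \sum_v g (u, v) = plan_cost (fun i j => (i == u)%:R) (fun u v => g (u, v)).
  rewrite -(sum_indicator u (fun i => \sum_v g (i, v))).
  by apply: eq_bigr => i _; rewrite mulr_sumr.
have colE v (g : T) :
    \sum_u g (u, v) = plan_cost (fun i j => (j == v)%:R) (fun u v => g (u, v)).
  by apply: eq_bigr => i _; rewrite sum_indicator.
pose B : set T := [set g : T | forall e, `[0, mu e.1]%classic (g e)].
pose rowS : set T := \bigcap_(u in setT) [set g : T | \sum_v g (u, v) = mu u].
pose colS : set T := \bigcap_(v in setT) [set g : T | \sum_u g (u, v) = nu v].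
have Bcpt : compact B.
  apply: (@tychonoff _ (fun _ => R : topologicalType)
    (fun e => `[0, mu e.1]%classic)) => e'.
  exact: segment_compact.
have rowC : closed rowS.
  apply: closed_bigI => u _.
  rewrite (_ : [set _ | _] = (fun g : T => plan_cost (fun i j => (i == u)%:R)
     (fun u v => g (u, v))) @^-1` [set x | x = mu u]).
    by apply: preimage_closed; [move=> g _; exact: lin_cont | exact: closed_eq].
  by apply/seteqP; split=> g /=; rewrite rowE.
have colC : closed colS.
  apply: closed_bigI => u _.
  rewrite (_ : [set _ | _] = (fun g : T => plan_cost (fun i j => (j == u)%:R)
     (fun u v => g (u, v))) @^-1` [set x | x = nu u]).
    by apply: preimage_closed; [move=> g _; exact: lin_cont | exact: closed_eq].
  by apply/seteqP; split=> g /=; rewrite colE.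
pose P : set T := B `&` (rowS `&` colS).
have PP (g : T) : P g <-> plan mu nu (fun u v => g (u, v)).
  split=> [[Bg [rg cg]]|pg].
    split=> [u v|u|v]; [|exact: rg|exact: cg].
    by have /= := Bg (u, v); rewrite in_itv /= => /andP[].
  have [g0 gr gc] := pg; split; last by split=> u _ /=.
  move=> [u v] /=; rewrite in_itv /= g0 /=.
  exact: plan_le pg.
have Pcpt : compact P by apply: compact_closedI => //; exact: closedI.
have P0 : P !=set0.
  have [f fp] := plan_exists mu0 nu0 e.
  by exists (fun e => f e.1 e.2); apply/PP.
have [] := compact_EVT_min P0 Pcpt
  (f := fun g : T => plan_cost c (fun u v => g (u, v))).
  by apply: continuous_subspaceT; exact: lin_cont.
move=> g; rewrite inE => /PP pg gmin.
exists (fun u v => g (u, v)) => // h ph.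
by apply: (gmin (fun e => h e.1 e.2)); rewrite inE; apply/PP.
Qed.

End Plans.

(** * Removing transshipment *)

Section Transshipment.
Variables (R : realType) (V : finType).
Implicit Types (c f : V -> V -> R) (mu nu s : V -> R).

(** The excess [s u] is the mass that passes through [u] on top of what [u]
supplies or demands. *)
Let excess_plan mu nu s f :=
  plan (fun u => mu u + s u) (fun v => nu v + s v) f.

(** Mass on the loop at [v] is free and contributes equally to both marginals at
[v], so it can be removed against the excess.  Whichever of the two runs out
first decides the final alternative. *)
Lemma cancel_loop c mu nu s f v :
  c v v = 0 -> 0 <= s v -> excess_plan mu nu s f ->
  exists e f', [/\ 0 <= s v - e,
    excess_plan mu nu (fun u => s u - (u == v)%:R * e) f',
    plan_cost c f' = plan_cost c f & s v - e = 0 \/ f' v v = 0].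
Proof.
move=> cv sv [f0 fr fc]; pose e := Num.min (f v v) (s v).
exists e, (fun u w => f u w - (u == v)%:R * ((w == v)%:R * e)).
have el : e <= f v v by rewrite ge_min lexx.
have er : e <= s v by rewrite ge_min lexx orbT.
split; first by rewrite subr_ge0.
- split=> [u w|u|w].
  + case: eqP => [->|]; last by rewrite mul0r subr0.
    case: eqP => [->|]; last by rewrite mul0r mulr0 subr0.
    by rewrite !mul1r subr_ge0.
  + by rewrite sumrB fr -mulr_sumr sum_indicator addrA.
  + by rewrite sumrB fc sum_indicator addrA.
- rewrite /plan_cost.
  under eq_bigr do under eq_bigr do rewrite mulrBr.
  under eq_bigr do rewrite sumrB.
  rewrite sumrB [X in _ - X](_ : _ = 0) ?subr0 //.
  rewrite big1 // => u _; rewrite big1 // => w _.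
  case: eqP => [->|]; last by rewrite mul0r mulr0.
  case: eqP => [->|]; last by rewrite mul0r !mulr0.
  by rewrite cv mul0r.
- rewrite eqxx !mul1r /e; case: (leP (f v v) (s v)) => _.
    by right; rewrite subrr.
  by left; rewrite subrr.
Qed.

(** A fraction [s v / (nu v + s v)] of every arrival at [v] and a fraction
[s v / (mu v + s v)] of every departure is transit mass.  It is replaced by
direct transport from origins to destinations, coupled proportionally to both;
the other marginals are unchanged and the triangle inequality bounds the cost.
Without the condition on [f v v], subtracting both fractions from the loop could
make it negative. *)
Lemma shortcut_vertex c mu nu s f v :
  (forall x y z, c x z <= c x y + c y z) ->
  0 <= mu v -> 0 <= nu v -> 0 < s v -> f v v = 0 ->
  excess_plan mu nu s f ->
  exists2 f', excess_plan mu nu (fun u => s u - (u == v)%:R * s v) f'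
            & plan_cost c f' <= plan_cost c f.
Proof.
move=> tri mv nv sv fv [f0 fr fc]; set a := s v.
pose r := mu v + a; pose k := nu v + a.
have r0 : 0 < r by rewrite ltr_wpDl.
have k0 : 0 < k by rewrite ltr_wpDl.
have rn := lt0r_neq0 r0; have kn := lt0r_neq0 k0.
have q0 : 0 <= a / (k * r) by rewrite divr_ge0 ?mulr_ge0 // ltW.
have fvr : \sum_w f v w = r by rewrite fr.
have fvk : \sum_u f u v = k by rewrite fc.
exists (fun u w => f u w - (w == v)%:R * (f u v * (a / k))
   - (u == v)%:R * (f v w * (a / r)) + a / (k * r) * (f u v * f v w)).
  split=> [u w|u|w].
  - have ak : f u v * (a / k) <= f u v.
      by rewrite ler_piMr // ler_pdivrMr // mul1r lerDr.
    have ar : f v w * (a / r) <= f v w.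
      by rewrite ler_piMr // ler_pdivrMr // mul1r lerDr.
    have [->|_] := eqVneq w v; have [->|_] := eqVneq u v;
      rewrite ?fv ?mul0r ?mulr0 ?mul0r ?mul1r ?subr0 ?addr0 ?subr_ge0 //.
    by rewrite addr_ge0 // mulr_ge0 // mulr_ge0.
  - rewrite big_split /= !sumrB fr sum_indicator -!mulr_sumr -mulr_suml fvr.
    by field; rewrite rn kn.
  - rewrite big_split /= !sumrB fc sum_indicator -!mulr_sumr -!mulr_suml fvk.
    by field; rewrite rn kn.
(* The cost is compared through the total costs of arriving at and leaving
   [v], both before the shortcut. *)
pose into := \sum_u c u v * f u v; pose out := \sum_w c v w * f v w.
have -> : plan_cost c (fun u w => f u w - (w == v)%:R * (f u v * (a / k))
      - (u == v)%:R * (f v w * (a / r)) + a / (k * r) * (f u v * f v w))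
    = plan_cost c f - into * (a / k) - out * (a / r)
      + a / (k * r) * \sum_u \sum_w c u w * (f u v * f v w).
  have -> : into * (a / k)
      = \sum_u \sum_w (w == v)%:R * (c u w * (f u v * (a / k))).
    by rewrite mulr_suml; apply: eq_bigr => u _; rewrite sum_indicator -mulrA.
  have -> : out * (a / r)
      = \sum_u \sum_w (u == v)%:R * (c u w * (f v w * (a / r))).
    rewrite exchange_big mulr_suml; apply: eq_bigr => w _.
    by rewrite sum_indicator -mulrA.
  rewrite mulr_sumr -!sumrB -big_split; apply: eq_bigr => u _ /=.
  rewrite mulr_sumr -!sumrB -big_split; apply: eq_bigr => w _ /=.
  by ring.
have le_detour :
    \sum_u \sum_w c u w * (f u v * f v w) <= into * r + k * out.
  rewrite -fvr -fvk mulr_suml [X in _ <= _ + X]mulr_suml -big_split /=.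
  apply: ler_sum => u _; rewrite !mulr_sumr -big_split /=.
  apply: ler_sum => w _.
  have -> : c u v * f u v * f v w + f u v * (c v w * f v w)
      = (c u v + c v w) * (f u v * f v w) by ring.
  by rewrite ler_wpM2r // mulr_ge0.
have := ler_wpM2l q0 le_detour.
have -> : a / (k * r) * (into * r + k * out) = into * (a / k) + out * (a / r).
  by field; rewrite rn kn.
by lra.
Qed.

(** Clearing the excess at one vertex leaves the excess at the others unchanged,
so the vertices can be treated one after the other. *)
Lemma remove_transshipment c mu nu s f :
  (forall x, c x x = 0) -> (forall x y z, c x z <= c x y + c y z) ->
  (forall u, 0 <= mu u) -> (forall u, 0 <= nu u) -> (forall u, 0 <= s u) ->
  excess_plan mu nu s f ->
  exists2 f', plan mu nu f' & plan_cost c f' <= plan_cost c f.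
Proof.
move=> c0 tri mu0 nu0 s0 pf.
have one v s1 f1 : (forall u, 0 <= s1 u) -> excess_plan mu nu s1 f1 ->
    exists2 f2, excess_plan mu nu (fun u => s1 u - (u == v)%:R * s1 v) f2
              & plan_cost c f2 <= plan_cost c f1.
  move=> s10 pf1.
  have [e [f2 [se pf2 c2 or2]]] := cancel_loop (c0 v) (s10 v) pf1.
  have [se0|se_neq0] := eqVneq (s1 v - e) 0.
    exists f2; last by rewrite c2.
    by have -> : s1 v = e by apply/eqP; rewrite -subr_eq0 se0.
  case: or2 => [/eqP|f2v]; first by rewrite (negbTE se_neq0).
  have [] := shortcut_vertex tri (mu0 v) (nu0 v) _ f2v pf2.
    by rewrite eqxx mul1r lt_def se_neq0.
  move=> f3 pf3 c3; exists f3; last by rewrite -c2.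
  suff -> : (fun u => s1 u - (u == v)%:R * s1 v) =
    (fun u => s1 u - (u == v)%:R * e
              - (u == v)%:R * (s1 v - (v == v)%:R * e)) by [].
  by apply/funext => u; rewrite eqxx mul1r; ring.
have all_of (r : seq V) : exists s' f', [/\ forall u, 0 <= s' u,
    {in r, forall u, s' u = 0}, excess_plan mu nu s' f'
    & plan_cost c f' <= plan_cost c f].
  elim: r => [|v r [s1 [f1 [s10 s1r pf1 c1]]]]; first by exists s, f; split.
  have [f2 pf2 c2] := one v s1 f1 s10 pf1.
  exists (fun u => s1 u - (u == v)%:R * s1 v), f2; split=> //.
  - by move=> u; case: eqP => [->|_]; rewrite ?mul1r ?subrr // mul0r subr0.
  - move=> u; rewrite in_cons; case: eqP => [->|_ /= ur].
      by rewrite mul1r subrr.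
    by rewrite mul0r subr0 s1r.
  - exact: le_trans c1.
have [s' [f' [_ s'0 [f'0 fr fc] cf]]] := all_of (enum V).
exists f' => //; split=> [//|u|v].
  by rewrite fr s'0 ?addr0 ?mem_enum.
by rewrite fc s'0 ?addr0 ?mem_enum.
Qed.

End Transshipment.

(** * Flows on the complete graph and transport plans *)

Section CompleteFlows.
Variables (R : realType) (V : finType) (c : V -> V -> R).
Hypothesis c0 : forall x, c x x = 0.
Hypothesis tri : forall x y z, c x z <= c x y + c y z.
Implicit Types (f : V -> V -> R) (mu nu b : V -> R).

Lemma flow_cost_complete f :
  flow_cost (@complete_digraph V) c f = plan_cost c f.
Proof.
rewrite /plan_cost pair_bigA /= /flow_cost.
rewrite [RHS](bigID (fun e => e.1 != e.2)) /=.
rewrite [X in _ + X]big1 ?addr0 // => -[u v] /= /negPn /eqP ->.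
by rewrite c0 mul0r.
Qed.

(** The divergence of a plan is the difference of its marginals; its diagonal
entries, which are not on edges, cancel in it. *)
Lemma plan_is_flow mu nu f :
  plan mu nu f -> flows (@complete_digraph V) (fun u => mu u - nu u) f.
Proof.
move=> [f0 fr fc]; split=> [u v _|u]; first exact: f0.
rewrite -fr -fc /= [X in _ = X - _](bigD1 u) // [X in _ = _ - X](bigD1 u) //=.
rewrite opprD addrACA subrr add0r.
by congr (_ - _); apply: eq_bigl => v /=; rewrite eq_sym.
Qed.

Lemma flow_to_plan mu nu f :
  (forall u, 0 <= mu u) -> (forall u, 0 <= nu u) ->
  flows (@complete_digraph V) (fun u => mu u - nu u) f ->
  exists2 g, plan mu nu g
           & plan_cost c g <= flow_cost (@complete_digraph V) c f.
Proof.
move=> mu0 nu0 [f0 fb].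
(* Keeping the supply [mu u] in place at [u] turns the outflow into excess: the
   row sum is [mu u + out u], and the column sum is [nu u + out u] by flow
   conservation. *)
pose out u := \sum_(v | u != v) f u v.
pose g u v := if u == v then mu u else f u v.
have gE : plan_cost c g = flow_cost (@complete_digraph V) c f.
  rewrite flow_cost_complete; apply: eq_bigr => u _; apply: eq_bigr => v _.
  by rewrite /g; case: eqP => // ->; rewrite c0 !mul0r.
have out0 u : 0 <= out u by apply: sumr_ge0 => v; exact: f0.
rewrite -gE; apply: (remove_transshipment (s := out) c0 tri mu0 nu0 out0).
split=> [u v|u|v].
- by rewrite /g; case: eqP => // /eqP; exact: f0.
- rewrite (bigD1 u) //= {1}/g eqxx; congr (_ + _).
  rewrite /out; apply: eq_big => [v|v]; first by rewrite eq_sym.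
  by rewrite /g eq_sym => /negbTE ->.
- rewrite (bigD1 v) //= {1}/g eqxx.
  rewrite (eq_bigr (fun u => f u v)); last first.
    by move=> u; rewrite /g => /negbTE ->.
  have := fb v; rewrite /= -/(out v); lra.
Qed.

(** An optimal plan is also an optimal flow, as every flow is dominated by a
plan. *)
Lemma transport_min mu nu :
  (forall u, 0 <= mu u) -> (forall u, 0 <= nu u) ->
  \sum_u mu u = \sum_u nu u ->
  exists m, [/\ exists2 f, plan mu nu f & plan_cost c f = m,
     forall f, plan mu nu f -> m <= plan_cost c f,
     flow_costs (@complete_digraph V) c (fun u => mu u - nu u) m
   & lbound (flow_costs (@complete_digraph V) c (fun u => mu u - nu u)) m].
Proof.
move=> mu0 nu0 e; have [f pf fmin] := plan_cost_min c mu0 nu0 e.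
exists (plan_cost c f); split=> //; first by exists f.
  by exists f; [exact: plan_is_flow | exact: flow_cost_complete].
move=> _ [g gb <-]; have [h ph hg] := flow_to_plan mu0 nu0 gb.
by rewrite (le_trans _ hg) // fmin.
Qed.

End CompleteFlows.

(** * Graphs containing geodesics *)

Section GeodesicGraphs.
Variables (R : realType) (V : finType) (G : rel V) (c : V -> V -> R).
Implicit Types (f g : V -> V -> R) (b : V -> R).

(** The flow of one unit along a path; an edge used several times counts with
multiplicity. *)
Fixpoint path_flow (x : V) (p : seq V) (u v : V) : R :=
  if p is y :: p' then (u == x)%:R * (v == y)%:R + path_flow y p' u v else 0.

Lemma path_flow_ge0 x p u v : 0 <= path_flow x p u v.
Proof. by elim: p x => //= y p IH x; rewrite addr_ge0 ?mulr_ge0. Qed.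

Lemma path_flow_divergence x p u : path G x p ->
  \sum_(v | G u v) path_flow x p u v - \sum_(v | G v u) path_flow x p v u
  = (u == x)%:R - (u == last x p)%:R.
Proof.
elim: p x => [x _|y p IH x] /=; first by rewrite !big1 // !subrr.
case/andP=> Gxy /IH {}IH; rewrite !big_split /= opprD addrACA {}IH.
rewrite [X in X - _](_ : _ = (u == x)%:R); last first.
  rewrite big_mkcond (bigD1 y) //= big1 => [|v /negbTE ->]; last first.
    by rewrite mulr0 if_same.
  rewrite eqxx mulr1 addr0; case: eqP => [->|_]; last by rewrite if_same.
  by rewrite Gxy.
rewrite [X in _ - X + _](_ : _ = (u == y)%:R); first by rewrite addrA subrK.
rewrite big_mkcond (bigD1 x) //= big1 => [|v /negbTE ->]; last first.
  by rewrite mul0r if_same.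
rewrite eqxx mul1r addr0; case: eqP => [->|_]; last by rewrite if_same.
by rewrite Gxy.
Qed.

Lemma flow_cost_path x p : path G x p ->
  flow_cost G c (path_flow x p) = \sum_(w <- pairmap c x p) w.
Proof.
rewrite /flow_cost; elim: p x => [x _|y p IH x] /=.
  by rewrite big_nil big1 // => e _; rewrite mulr0.
case/andP=> Gxy /IH {}IH; rewrite big_cons -IH.
under eq_bigr do rewrite mulrDr.
rewrite big_split /=; congr (_ + _).
rewrite (bigD1 (x, y)) //= !eqxx !mulr1 big1 ?addr0 // => -[u v] /= /andP[_].
by rewrite xpair_eqE; do 2!case: eqP; rewrite ?mulr0 ?mul0r ?mulr0.
Qed.

Lemma le_path_cost x p :
  (forall x, c x x = 0) -> (forall x y z, c x z <= c x y + c y z) ->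
  c x (last x p) <= \sum_(w <- pairmap c x p) w.
Proof.
move=> c0 tri; elim: p x => [x|y p IH x] /=; first by rewrite big_nil c0.
by rewrite big_cons (le_trans (tri x y _)) // lerD2l.
Qed.

Lemma path_dist_geodesic x y :
  (forall x, c x x = 0) -> (forall x y z, c x z <= c x y + c y z) ->
  path_costs G c x y (c x y) -> path_dist G c x y = c x y.
Proof.
move=> c0 tri geo; apply: minimum_eq => // _ [p [_ <-] <-].
exact: le_path_cost.
Qed.

(** Rerouting along geodesics: the flow on [G] is the superposition of the unit
flows of chosen geodesics, weighted by the given flow. *)
Lemma flow_costs_geodesic b :
  irreflexive G -> (forall x y, path_costs G c x y (c x y)) ->
  flow_costs G c b = flow_costs (@complete_digraph V) c b.
Proof.
move=> Girr geo; apply/seteqP; split=> _ [f [f0 fb] <-].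
  have Gneq u v : G u v -> u != v by apply: contraTN => /eqP ->; rewrite Girr.
  have mask (P Q : pred V) (F : V -> R) : (forall v, Q v -> P v) ->
      \sum_(v | P v) (if Q v then F v else 0) = \sum_(v | Q v) F v.
    move=> QP; rewrite -big_mkcondr; apply: eq_bigl => v.
    by case: (Q v) (QP v) => [->|]; rewrite ?andbF.
  exists (fun u v => if G u v then f u v else 0).
    split=> [u v _|u]; first by case: ifP => // /f0.
    rewrite (mask _ (G u)) => [|v /Gneq //].
    by rewrite (mask _ (G^~ u)) ?fb // => v /Gneq.
  rewrite /flow_cost; under eq_bigr do rewrite (fun_if ( *%R _)) mulr0.
  rewrite -big_mkcondr; apply: eq_bigl => -[u v] /=.
  by case: (boolP (G u v)) => [/Gneq|]; rewrite ?andbT ?andbF.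
have /choice[P PP] : forall e : V * V, exists p,
    [/\ path G e.1 p, last e.1 p = e.2
      & \sum_(w <- pairmap c e.1 p) w = c e.1 e.2].
  by move=> [x y]; have [p [Gp lp] cp] := geo x y; exists p.
pose F u v := \sum_(e : V * V | e.1 != e.2) f e.1 e.2 * path_flow e.1 (P e) u v.
exists F.
  split=> [u v _|u].
    by apply: sumr_ge0 => e /f0 fe; rewrite mulr_ge0 ?path_flow_ge0.
  rewrite exchange_big [X in _ - X]exchange_big -sumrB /=.
  (* Each edge now contributes as if its mass still travelled directly, because
     a path flow has divergence only at the endpoints. *)
  transitivity (\sum_(e : V * V | e.1 != e.2)
      f e.1 e.2 * ((u == e.1)%:R - (u == e.2)%:R)).
    apply: eq_bigr => e _; have [Gp <- _] := PP e.
    by rewrite -!mulr_sumr -mulrBr path_flow_divergence.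
  rewrite -fb; under eq_bigr do rewrite mulrBr.
  rewrite sumrB; congr (_ - _).
    rewrite -(pair_big_dep xpredT (fun x y => x != y)
      (fun x y => f x y * (u == x)%:R)) /=.
    rewrite (bigD1 u) //= [X in _ + X]big1 ?addr0 => [|x /negbTE xu].
      by apply: eq_bigr => y _; rewrite eqxx mulr1.
    by rewrite big1 // => y _; rewrite eq_sym xu mulr0.
  rewrite -(pair_big_dep xpredT (fun x y => x != y)
    (fun x y => f x y * (u == y)%:R)) /=.
  rewrite (exchange_big_dep xpredT) //=.
  rewrite (bigD1 u) //= [X in _ + X]big1 ?addr0 => [|x /negbTE xu].
    by apply: eq_bigr => y _; rewrite eqxx mulr1.
  by rewrite big1 // => y _; rewrite eq_sym xu mulr0.
rewrite /flow_cost; under eq_bigr do rewrite mulr_sumr.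
rewrite exchange_big /=; apply: eq_bigr => e _.
have [Gp _ <-] := PP e; rewrite -flow_cost_path // /flow_cost mulr_suml.
by apply: eq_bigr => e' _; ring.
Qed.

(** Every quotient in the gap is one.  Two distinct points are required for the
maximum to range over a nonempty set, since its unit is [-oo]. *)
Lemma gap_geodesic :
  (forall x, c x x = 0) -> (forall x y, x != y -> c x y != 0) ->
  (forall x y z, c x z <= c x y + c y z) ->
  (forall x y, path_costs G c x y (c x y)) ->
  (exists x y : V, x != y) -> gap G c = 0%:E.
Proof.
move=> c0 cpos tri geo [x [y xy]].
have term e : e.1 != e.2 -> (1 - c e.1 e.2 / path_dist G c e.1 e.2)%:E = 0%:E.
  by move=> /cpos ce; rewrite path_dist_geodesic // divff // subrr.
rewrite /gap (eq_bigr _ term); apply/le_anti/andP; split.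
  by apply/bigmax_leP; split=> //; rewrite leNye.
exact: (@le_bigmax_cond _ _ _ _ (x, y) (fun e => e.1 != e.2) (fun=> 0%:E)).
Qed.

End GeodesicGraphs.

(** * Geodesics of the lattice *)

Section LatticeGeodesics.
Variables (R : realType) (N : nat).
Implicit Types i j k : lattice N.

(** With truncated subtraction one of the two terms is zero, so this is the
absolute difference. *)
Definition ndist (a b : nat) : nat := (a - b) + (b - a).

Definition ndinf i j : nat := maxn (ndist i.1 j.1) (ndist i.2 j.2).

Lemma ndistE (a b : nat) : `|a%:R - b%:R| = (ndist a b)%:R :> R.
Proof.
rewrite /ndist; case: (leqP a b) => [ab|/ltnW ab].
  by rewrite (eqP ab) add0n distrC -natrB // normr_nat.
by rewrite (eqP ab) addn0 -natrB // normr_nat.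
Qed.

Lemma dinfE i j : dinf R i j = (ndinf i j)%:R.
Proof. by rewrite /dinf !ndistE -natr_max. Qed.

Lemma ndinf_eq0 i j : (ndinf i j == 0%N) = (i == j).
Proof.
case: i j => [i1 i2] [j1 j2].
by rewrite xpair_eqE -!val_eqE /ndinf /ndist /=; lia.
Qed.

Lemma ndinf_triangle i j k : (ndinf i k <= ndinf i j + ndinf j k)%N.
Proof. by rewrite /ndinf /ndist; lia. Qed.

Lemma G1E i k : G1 i k = (ndinf i k == 1%N).
Proof.
case: i k => [i1 i2] [k1 k2]; rewrite /G1 /V1 /ndinf /ndist /=.
move: (nat_of_ord i1) (nat_of_ord i2) (nat_of_ord k1) (nat_of_ord k2).
by move=> {i1 i2 k1 k2} a b x y; apply/idP/idP; lia.
Qed.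

Definition step_toward (a b : 'I_N) : 'I_N :=
  insubd a (if (a < b)%N then a.+1 else if (b < a)%N then a.-1 else a).

Lemma ndist_step_toward (a b : 'I_N) :
  ndist a (step_toward a b) = minn 1 (ndist a b)
  /\ ndist (step_toward a b) b = (ndist a b).-1.
Proof.
have bN := ltn_ord b; have aN := ltn_ord a.
rewrite /step_toward /ndist val_insubd.
by case: (ltnP a b) => ?; case: (ltnP b a) => ?; case: ifP => // ?; lia.
Qed.

(** Moving both coordinates one step towards the target is a single king move,
and it lowers the larger coordinate difference by exactly one. *)
Lemma lattice_geodesic i j :
  exists p, [/\ path (@G1 N) i p, last i p = j & size p = ndinf i j].
Proof.
move: {2}(ndinf i j) (erefl (ndinf i j)) => n; elim: n i => [|n IH] i dij.
  by exists [::]; split=> //; apply/eqP; rewrite -ndinf_eq0 dij.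
pose k : lattice N := (step_toward i.1 j.1, step_toward i.2 j.2).
have [ik kj] : ndinf i k = 1%N /\ ndinf k j = n.
  have [a1 b1] := ndist_step_toward i.1 j.1.
  have [a2 b2] := ndist_step_toward i.2 j.2.
  by move: dij; rewrite /ndinf /k /= a1 a2 b1 b2; lia.
have [p [Gp lp sp]] := IH k kj.
by exists (k :: p); split=> //=; rewrite ?G1E ?ik // sp kj dij.
Qed.

Lemma path_cost_size i p :
  path (@G1 N) i p -> \sum_(w <- pairmap (dinf R (N:=N)) i p) w = (size p)%:R.
Proof.
elim: p i => [|j p IH] i /=; first by rewrite big_nil.
case/andP; rewrite G1E => /eqP ij /IH {}IH.
by rewrite big_cons IH dinfE ij -natrD.
Qed.

Lemma dinf_path_costs i j :
  path_costs (@G1 N) (@dinf R N) i j (dinf R i j).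
Proof.
have [p [Gp lp sp]] := lattice_geodesic i j.
by exists p => //; rewrite path_cost_size // sp dinfE.
Qed.

End LatticeGeodesics.

(** * The identity of minimal costs *)

Theorem proposition3p2 (R : realType) (N : nat) (hN : (2 <= N)%N) :
  [/\ gap (@G1 N) (@dinf R N) = 0%:E,
      forall b : lattice N -> R, \sum_(i : lattice N) b i = 0 ->
        [/\ has_min (flow_costs (@G1 N) (@dinf R N) b),
            has_min (flow_costs (@complete_digraph _) (@dinf R N) b)
          & min_flow_cost (@G1 N) (@dinf R N) b
            = min_flow_cost (@complete_digraph _) (@dinf R N) b]
    & forall mu nu : lattice N -> R, prob_vector mu -> prob_vector nu ->
        wasserstein (@dinf R N) mu nu
        = min_flow_cost (@G1 N) (@dinf R N) (fun i => mu i - nu i)].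
Proof.
have d0 (i : lattice N) : dinf R i i = 0.
  by apply/eqP; rewrite dinfE pnatr_eq0 ndinf_eq0.
have dneq0 (i j : lattice N) : i != j -> dinf R i j != 0.
  by rewrite dinfE pnatr_eq0 ndinf_eq0.
have tri (i j k : lattice N) : dinf R i k <= dinf R i j + dinf R j k.
  by rewrite !dinfE -natrD ler_nat ndinf_triangle.
have geo := @dinf_path_costs R N.
have eqFlows b := flow_costs_geodesic b _ geo.
have irr : irreflexive (@G1 N).
  move=> i; have /eqP : ndinf i i == 0%N by rewrite ndinf_eq0.
  by rewrite G1E => ->.
split.
- apply: gap_geodesic => //.
  pose o : 'I_N := Ordinal (ltnW hN); pose l : 'I_N := Ordinal hN.
  by exists (o, o), (l, l); rewrite xpair_eqE.
- move=> b sb; rewrite /min_flow_cost eqFlows //.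
  suff hm : has_min (flow_costs (@complete_digraph _) (@dinf R N) b) by [].
  (* The positive and negative parts of [b] have equal masses and difference
     [b]. *)
  pose mu i := Num.max (b i) 0; pose nu i := Num.max (- b i) 0.
  have bE i : mu i - nu i = b i.
    by rewrite /mu /nu; case: (leP (b i) 0) => ?;
      case: (leP (- b i) 0) => ?; lra.
  have [||| m [_ _ bm lbm]] := transport_min d0 tri (mu := mu) (nu := nu).
  + by move=> i; rewrite le_max lexx orbT.
  + by move=> i; rewrite le_max lexx orbT.
  + by apply/eqP; rewrite -subr_eq0 -sumrB (eq_bigr b) ?sb.
  by move: bm lbm; rewrite (funext bE) => bm lbm; exists m.
- move=> mu nu [mu0 mu1] [nu0 nu1].
  have e : \sum_i mu i = \sum_i nu i by rewrite mu1 nu1.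
  have [m [[f [f0 fr fc] fm] minm bm lbm]] := transport_min d0 tri mu0 nu0 e.
  rewrite /min_flow_cost eqFlows // (minimum_eq bm lbm).
  have costE (pi : lattice N * lattice N -> R) :
      \sum_xy dinf R xy.1 xy.2 * pi xy
      = plan_cost (@dinf R N) (fun x y => pi (x, y)).
    by rewrite /plan_cost pair_bigA; apply: eq_bigr => -[].
  apply: inf_eq_min.
    exists (fun e => f e.1 e.2); last by rewrite costE.
    split=> //; split=> //.
    by rewrite -(pair_bigA _ f) -mu1; apply: eq_bigr => i _; rewrite fr.
  move=> _ [pi [[pi0 _] pr pc] <-]; rewrite costE.
  by apply: minm; split.
Qed.
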